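(* For integers $k\ge 1$ and $n\ge 0$ let $A_{k,n}(q)$ be the rank generating function of $\hbox{Le}$-diagrams described in the context (with $A_{k,n}(q)=0$ for $n<k$). Set $A_k(q,x)=\sum_{n\ge 0}A_{k,n}(q)x^n$ and $A(q,x,y)=\sum_{k\ge1}\sum_{n\ge0}A_{k,n}(q)x^ny^k$. Then \[ A(q,x,y)=\frac{-y}{q(1-x)}+\sum_{i\ge1}\frac{y^i\,(q^{2i+1}-y)}{q^{i^2+i+1}\,\bigl(q^i-q^i[i+1]x+[i]xy\bigr)}, \] for every $k\ge1$ \[ A_k(q,x)=\sum_{i=0}^{k-1}(-1)^{i+k}\frac{x^{k-i-1}[i]^{k-i-1}}{q^{ki+i+1}(1-[i+1]x)^{k-i}}+\sum_{i=0}^{k}(-1)^{i+k}\frac{x^{k-i}[i]^{k-i}}{q^{ki}(1-[i+1]x)^{k-i+1}}, \] and for every $k\ge 1$, $n\ge0$, \[ A_{k,n}(q)=q^{-k^2}\sum_{i=0}^{k-1}(-1)^i\binom{n}{i}\Bigl(q^{ki}[k-i]^i[k-i+1]^{n-i}-q^{(k+1)i}[k-i-1]^i[k-i]^{n-i}\Bigr) =\sum_{i=0}^{k-1}\binom{n}{i}q^{-(k-i)^2}\Bigl([i-k]^i[k-i+1]^{n-i}-[i-k+1]^i[k-i]^{n-i}\Bigr). \]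
   Context: For an integer $m$ let $[m]=\frac{1-q^m}{1-q}$; so $[m]=1+q+\dots+q^{m-1}$ for $m\ge0$ (with $[0]=0$) and $[-m]=-q^{-m}[m]$. The convention $0^0=1$ is used. Fix $0\le k\le n$. A $\hbox{Le}$-diagram in a $k\times(n-k)$ rectangle is a pair $(\lambda,D)$ where $\lambda=(\lambda_1\ge\lambda_2\ge\dots\ge\lambda_k\ge0)$ is a partition with $\lambda_1\le n-k$, whose Young diagram $Y_\lambda$ has $\lambda_i$ left-justified boxes in row $i$ (row 1 on top), and $D:Y_\lambda\to\{0,1\}$ is a filling with the $\hbox{Le}$-property: there is no box filled with $0$ that has a box filled with $1$ somewhere above it in the same column and a box filled with $1$ somewhere to its left in the same row. The rank of $(\lambda,D)$ is the number of $1$'s in $D$. $A_{k,n}(q)=\sum q^{\mathrm{rank}(\lambda,D)}$ over all such diagrams. (By a theorem of Postnikov, the coefficient of $q^r$ in $A_{k,n}(q)$ is the number of $r$-dimensional cells in the cell decomposition of the totally nonnegative Grassmannian $Gr^+_{k,n}$ obtained by specifying which maximal minors are positive and which vanish.) All generating functions are elements of $\mathbb{Z}[q,q^{-1}][[x,y]]$; each factor $1/(q^i-q^i[i+1]x+[i]xy)$ and $1/(1-[i+1]x)$ denotes the inverse in this ring (its constant term in $x,y$ is invertible). *)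

(* Defs.v *)
From HB Require Import structures.
From mathcomp Require Import all_boot all_order all_algebra.
From mathcomp Require Import fraction.
Set Implicit Arguments.
Unset Strict Implicit.
Unset Printing Implicit Defensive.
Import Order.TTheory GRing.Theory Num.Theory.
Local Open Scope ring_scope.

(* Coefficient field: Q(q) realised as the fraction field of Z[q];
   Z[q,q^-1] embeds in it, and q is the indeterminate. *)
Definition K : fieldType := {fraction {poly int}}.
Definition q : K := tofrac ('X : {poly int}).

Definition qint (m : int) : K := (1 - q ^ m) / (1 - q).

(* In a k x m rectangle (m = n - k): lam i = lambda_(i+1) in {0..m},
   D is the filling, extended by false outside the Young diagram. *)
Definition le_diag (k m : nat) (lam : {ffun 'I_k -> 'I_m.+1})
  (D : {ffun 'I_k * 'I_m -> bool}) : bool :=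
  [&& [forall i : 'I_k, forall i' : 'I_k, (i <= i')%N ==> (lam i' <= lam i)%N],
      [forall ij : 'I_k * 'I_m, D ij ==> (ij.2 < lam ij.1)%N] &
      [forall i : 'I_k, forall j : 'I_m,
         ((j < lam i)%N && ~~ D (i, j)) ==>
         ~~ ([exists i' : 'I_k, (i' < i)%N && D (i', j)] &&
             [exists j' : 'I_m, (j' < j)%N && D (i, j')])]].

Definition le_rank (k m : nat) (D : {ffun 'I_k * 'I_m -> bool}) : nat :=
  #|[set ij | D ij]|.

Definition Akn (k n : nat) : K :=
  if (k <= n)%N then
    \sum_(p : {ffun 'I_k -> 'I_(n - k).+1} * {ffun 'I_k * 'I_(n - k) -> bool}
          | le_diag p.1 p.2) q ^+ le_rank p.2
  else 0.

(* f a b = coefficient of x^a y^b *)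
Definition ps := nat -> nat -> K.

Definition psmon (c : K) (a0 b0 : nat) : ps :=
  fun a b => if (a == a0) && (b == b0) then c else 0.
Definition psadd (f g : ps) : ps := fun a b => f a b + g a b.
Definition psscale (c : K) (f : ps) : ps := fun a b => c * f a b.
Definition psmul (f g : ps) : ps :=
  fun a b => \sum_(i < a.+1) \sum_(j < b.+1) f i j * g (a - i)%N (b - j)%N.
Fixpoint pspow (f : ps) (n : nat) : ps :=
  match n with 0 => psmon 1 0 0 | n'.+1 => psmul f (pspow f n') end.

(* Multiplicative inverse of a series with invertible constant term,
   computed by the standard recursion on the total degree a + b. *)
Fixpoint inv_aux (f : ps) (fuel a b : nat) : K :=
  match fuel with
  | 0 => (f 0%N 0%N)^-1
  | fuel'.+1 =>
      if (a + b == 0)%N then (f 0%N 0%N)^-1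
      else - (f 0%N 0%N)^-1 *
           \sum_(i < a.+1) \sum_(j < b.+1)
              (if (i + j == 0)%N then 0
               else f i j * inv_aux f fuel' (a - i)%N (b - j)%N)
  end.
Definition psinv (f : ps) : ps := fun a b => inv_aux f (a + b)%N a b.

Definition ps_sum (F : nat -> ps) (S : ps) : Prop :=
  forall a b, exists N, forall M, (N <= M)%N -> \sum_(i < M) F i a b = S a b.

Definition Aser : ps := fun a b => if b == 0%N then 0 else Akn b a.
Definition Akser (k : nat) : ps := fun a b => if b == 0%N then Akn k a else 0.

Definition gf_first : ps :=
  psscale (- q^-1) (psmul (psmon 1 0 1) (psinv (psadd (psmon 1 0 0) (psmon (-1) 1 0)))).

Definition gf_term (i : nat) : ps :=
  psscale (q ^- (i * i + i + 1))
    (psmul (psadd (psmon (q ^+ (2 * i + 1)) 0 i) (psmon (-1) 0 i.+1))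
       (psinv (psadd (psmon (q ^+ i) 0 0)
                 (psadd (psmon (- (q ^+ i * qint (i.+1)%:Z)) 1 0)
                        (psmon (qint i%:Z) 1 1))))).

Definition one_minus (i : nat) : ps :=
  psadd (psmon 1 0 0) (psmon (- qint (i.+1)%:Z) 1 0).

Definition Ak_term1 (k i : nat) : ps :=
  psscale ((-1) ^+ (i + k) * q ^- (k * i + i + 1))
    (psmul (psmon (qint i%:Z ^+ (k - i - 1)) (k - i - 1) 0)
           (psinv (pspow (one_minus i) (k - i)))).

Definition Ak_term2 (k i : nat) : ps :=
  psscale ((-1) ^+ (i + k) * q ^- (k * i))
    (psmul (psmon (qint i%:Z ^+ (k - i)) (k - i) 0)
           (psinv (pspow (one_minus i) (k - i).+1))).

(* Main.v *)
Require Import Defs.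
From mathcomp Require Import all_boot all_order all_algebra.
From mathcomp Require Import fraction ring zify.
Import GRing.Theory.
Local Open Scope ring_scope.

(* Call a row of a Le-diagram free if none of its 0s has a 1 above it, and let
   W k m t be the generating function of the diagrams in a k x m rectangle with
   weight q^rank t^(number of free rows). Every diagram either has an empty
   bottom row, or is obtained by adding a full column on the left, whose 1s may
   be placed exactly in the free rows; this gives a recursion relating W at t
   and at 1 + q t. Along t = [1], [2], [3], ... it becomes
     q^(j+1) f_(n+1)(j) = (q^(j+1) [j+1] y - q [j]) f_n(j) + q [j+1] f_n(j+1)
   for f_n(j) = sum_k y^k W k (n-k) [j+1]. This operator has the eigenvalues
   lam_i = [i+1] - q^(-i) [i] y, with explicit eigenfunctions E_i divisible by
   y^i, and f_0 = 1 is congruent to sum_(i < N) (1 - y q^(-2i-1)) E_i modulo y^N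
   because that sum telescopes. Hence f_n = sum_i lam_i^n (1 - y q^(-2i-1)) E_i,
   and all the formulas are read off at j = 0, where E_i(0) = y^i q^(-i^2). *)

(** * Quantifiers over ordinals, split at the first or the last index *)

Lemma forallb_recl n (P : pred 'I_n.+1) :
  [forall i, P i] = P ord0 && [forall i : 'I_n, P (lift ord0 i)].
Proof.
apply/forallP/andP => [H|[H0 /forallP H] i]; first by split; [|apply/forallP].
by case: (unliftP ord0 i) => [i'|] ->.
Qed.

Lemma forallb_recr n (P : pred 'I_n.+1) :
  [forall i, P i] = [forall i : 'I_n, P (lift ord_max i)] && P ord_max.
Proof.
apply/forallP/andP => [H|[/forallP H H0] i]; first by split; [apply/forallP|].
by case: (unliftP ord_max i) => [i'|] ->.
Qed.

Lemma existsb_recl n (P : pred 'I_n.+1) :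
  [exists i, P i] = P ord0 || [exists i : 'I_n, P (lift ord0 i)].
Proof. by apply: negb_inj; rewrite negb_or !negb_exists forallb_recl. Qed.

Lemma existsb_recr n (P : pred 'I_n.+1) :
  [exists i, P i] = [exists i : 'I_n, P (lift ord_max i)] || P ord_max.
Proof. by apply: negb_inj; rewrite negb_or !negb_exists forallb_recr. Qed.

Lemma forallb_and (T : finType) (P Q : pred T) :
  [forall i, P i && Q i] = [forall i, P i] && [forall i, Q i].
Proof.
apply/forallP/andP => [H|[/forallP HP /forallP HQ] i]; last by rewrite HP HQ.
by split; apply/forallP => i; case/andP: (H i).
Qed.

Lemma card_ordE n (P : pred 'I_n) : #|[set i | P i]| = (\sum_(i < n) P i)%N.
Proof. by rewrite -sum1_card big_mkcond; apply: eq_bigr => i _; rewrite inE; case: (P i). Qed.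

(** * Free rows, and rank and free-row counts as sums over rows *)

Definition free_row {k m} (lam : {ffun 'I_k -> 'I_m.+1})
  (D : {ffun 'I_k * 'I_m -> bool}) (i : 'I_k) : bool :=
  [forall j : 'I_m, ((j < lam i)%N && ~~ D (i, j)) ==>
                    ~~ [exists i' : 'I_k, (i' < i)%N && D (i', j)]].

Definition free_rows {k m} (lam : {ffun 'I_k -> 'I_m.+1}) (D : {ffun 'I_k * 'I_m -> bool}) :=
  #|[set i | free_row lam D i]|.

Lemma le_rankE k m (D : {ffun 'I_k * 'I_m -> bool}) :
  le_rank D = (\sum_(i < k) \sum_(j < m) D (i, j))%N.
Proof.
rewrite /le_rank pair_big -sum1_card big_mkcond; apply: eq_bigr => -[i j] _.
by rewrite inE; case: (D _).
Qed.

Lemma free_rowsE k m (lam : {ffun 'I_k -> 'I_m.+1}) (D : {ffun 'I_k * 'I_m -> bool}) :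
  free_rows lam D = (\sum_(i < k) free_row lam D i)%N.
Proof. exact: card_ordE. Qed.

(** * Appending an empty bottom row *)

Definition add_row {k m} (p : {ffun 'I_k -> 'I_m.+1} * {ffun 'I_k * 'I_m -> bool}) :
  {ffun 'I_k.+1 -> 'I_m.+1} * {ffun 'I_k.+1 * 'I_m -> bool} :=
  ([ffun i => if unlift ord_max i is Some i' then p.1 i' else ord0],
   [ffun ij => if unlift ord_max ij.1 is Some i' then p.2 (i', ij.2) else false]).

Definition del_row {k m} (p : {ffun 'I_k.+1 -> 'I_m.+1} * {ffun 'I_k.+1 * 'I_m -> bool}) :
  {ffun 'I_k -> 'I_m.+1} * {ffun 'I_k * 'I_m -> bool} :=
  ([ffun i => p.1 (lift ord_max i)], [ffun ij => p.2 (lift ord_max ij.1, ij.2)]).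

Lemma widen_liftE k (i : 'I_k) : widen_ord (leqnSn k) i = lift ord_max i.
Proof. by apply: val_inj; rewrite /= /bump leqNgt ltn_ord. Qed.

Lemma lift_maxE k (i : 'I_k) : (lift ord_max i : nat) = i.
Proof. by rewrite -widen_liftE. Qed.

Lemma lift_0E k (i : 'I_k) : (lift ord0 i : nat) = i.+1.
Proof. by []. Qed.

Section AddRow.
Context {k m : nat} (p : {ffun 'I_k -> 'I_m.+1} * {ffun 'I_k * 'I_m -> bool}).

Lemma add_row1_lift i : (add_row p).1 (lift ord_max i) = p.1 i.
Proof. by rewrite ffunE liftK. Qed.
Lemma add_row1_max : (add_row p).1 ord_max = ord0.
Proof. by rewrite ffunE unlift_none. Qed.
Lemma add_row2_lift i j : (add_row p).2 (lift ord_max i, j) = p.2 (i, j).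
Proof. by rewrite ffunE liftK. Qed.
Lemma add_row2_max j : (add_row p).2 (ord_max, j) = false.
Proof. by rewrite ffunE unlift_none. Qed.

Let rowE := (add_row1_lift, add_row1_max, add_row2_lift, add_row2_max).

Lemma add_rowK : del_row (add_row p) = p.
Proof.
case: p rowE => lam D E; rewrite /del_row; congr (_, _); apply/ffunP => x; rewrite ffunE ?E //.
by case: x => i j.
Qed.

Lemma exists_above_add_row (n : nat) j : (n <= k)%N ->
  [exists i' : 'I_k.+1, (i' < n)%N && (add_row p).2 (i', j)] =
  [exists i' : 'I_k, (i' < n)%N && p.2 (i', j)].
Proof.
move=> le_nk; rewrite existsb_recr rowE andbF orbF.
by apply: eq_existsb => i; rewrite rowE lift_maxE.
Qed.

Lemma row_free_add_row i :
  free_row (add_row p).1 (add_row p).2 (lift ord_max i) = free_row p.1 p.2 i.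
Proof.
apply: eq_forallb => j; rewrite !rowE lift_maxE exists_above_add_row //.
exact/ltnW.
Qed.

(** A row of length 0 has no boxes, so it is free vacuously; this is the source of the factor [t] in
    [le_gf_row0]. *)
Lemma row_free_add_row_max : free_row (add_row p).1 (add_row p).2 ord_max.
Proof. by apply/forallP => j; rewrite rowE. Qed.

Lemma le_diag_add_row :
  le_diag (add_row p).1 (add_row p).2 = le_diag p.1 p.2.
Proof.
rewrite /le_diag; congr [&& _, _ & _].
- rewrite forallb_recr andbC; have -> : [forall i' : 'I_k.+1, (@ord_max k <= i')%N ==>
     ((add_row p).1 i' <= (add_row p).1 ord_max)%N].
    apply/forallP => i'; apply/implyP => le_k.
    by have -> : i' = ord_max by apply/val_inj/eqP; rewrite eqn_leq le_k -ltnS ltn_ord.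
  rewrite andTb; apply: eq_forallb => i; rewrite forallb_recr !rowE leq0n implybT andbT.
  by apply: eq_forallb => i'; rewrite !rowE !lift_maxE.
- apply/forallP/forallP => H [i j].
    by have := H (lift ord_max i, j); rewrite /= !rowE.
  by case: (unliftP ord_max i) => [i'|] -> /=; rewrite !rowE //; apply: (H (i', j)).
- rewrite forallb_recr; rewrite andbC; have -> : [forall j : 'I_m,
     (j < (add_row p).1 ord_max)%N && ~~ (add_row p).2 (ord_max, j) ==>
     ~~ ([exists i' : 'I_k.+1, (i' < @ord_max k)%N && (add_row p).2 (i', j)] &&
         [exists j' : 'I_m, (j' < j)%N && (add_row p).2 (ord_max, j')])].
    by apply/forallP => j; rewrite rowE.
  rewrite andTb;   apply: eq_forallb => i; apply: eq_forallb => j.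
  rewrite !rowE !lift_maxE exists_above_add_row; last exact/ltnW.
  congr (_ ==> ~~ (_ && _)); apply: eq_existsb => j'; by rewrite rowE.
Qed.

Lemma le_rank_add_row : le_rank (add_row p).2 = le_rank p.2.
Proof.
rewrite !le_rankE big_ord_recr /= [X in (_ + X)%N]big1 ?addn0 => [|j _]; last by rewrite rowE.
by apply: eq_bigr => i _; apply: eq_bigr => j _; rewrite widen_liftE rowE.
Qed.

Lemma free_rows_add_row :
  free_rows (add_row p).1 (add_row p).2 = (free_rows p.1 p.2).+1.
Proof.
rewrite !free_rowsE big_ord_recr /= row_free_add_row_max addn1; congr S.
by apply: eq_bigr => i _; rewrite widen_liftE row_free_add_row.
Qed.

End AddRow.

(** * Adding a full column on the left *)

Definition add_col {k m}
  (p : ({ffun 'I_k -> 'I_m.+1} * {ffun 'I_k * 'I_m -> bool}) * {ffun 'I_k -> bool}) :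
  {ffun 'I_k -> 'I_m.+2} * {ffun 'I_k * 'I_m.+1 -> bool} :=
  ([ffun i => lift ord0 (p.1.1 i)],
   [ffun ij => if unlift ord0 ij.2 is Some j' then p.1.2 (ij.1, j') else p.2 ij.1]).

(** The default [ord0] is reached only at rows of length 0; on diagrams with all rows nonempty
    [del_col] is a two-sided inverse of [add_col]. *)
Definition del_col {k m} (p : {ffun 'I_k -> 'I_m.+2} * {ffun 'I_k * 'I_m.+1 -> bool}) :
  ({ffun 'I_k -> 'I_m.+1} * {ffun 'I_k * 'I_m -> bool}) * {ffun 'I_k -> bool} :=
  (([ffun i => odflt ord0 (unlift ord0 (p.1 i))],
    [ffun ij => p.2 (ij.1, lift ord0 ij.2)]), [ffun i => p.2 (i, ord0)]).

Section AddCol.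
Context {k m : nat}.
Variable (p : ({ffun 'I_k -> 'I_m.+1} * {ffun 'I_k * 'I_m -> bool}) * {ffun 'I_k -> bool}).

Lemma add_col1 i : (add_col p).1 i = lift ord0 (p.1.1 i).
Proof. by rewrite ffunE. Qed.
Lemma add_col2_lift i j : (add_col p).2 (i, lift ord0 j) = p.1.2 (i, j).
Proof. by rewrite ffunE liftK. Qed.
Lemma add_col2_0 i : (add_col p).2 (i, ord0) = p.2 i.
Proof. by rewrite ffunE unlift_none. Qed.

Let colE := (add_col1, add_col2_lift, add_col2_0, lift_0E, ltnS, ltn0Sn, leqn0).

Lemma add_colK : del_col (add_col p) = p.
Proof.
case: p colE => -[lam D] c E; rewrite /del_col; congr (_, _, _).
- by apply/ffunP => i; rewrite !ffunE liftK.
- by apply/ffunP => -[i j]; rewrite ffunE E.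
- by apply/ffunP => i; rewrite ffunE E.
Qed.

(** The old columns impose the old condition, and the new box destroys freeness exactly when it is a
    0 below a 1 of the new column. *)
Lemma row_free_add_col i :
  free_row (add_col p).1 (add_col p).2 i =
  free_row p.1.1 p.1.2 i && (p.2 i || ~~ [exists i' : 'I_k, (i' < i)%N && p.2 i']).
Proof.
rewrite /free_row forallb_recl andbC; congr (_ && _).
  apply: eq_forallb => j; rewrite !colE; congr (_ ==> ~~ _).
  by apply: eq_existsb => i'; rewrite colE.
rewrite !colE /= implyNb; congr (_ || ~~ _).
by apply: eq_existsb => i'; rewrite colE.
Qed.

(** A new 1 at the left end of a row makes every 0 of that row with a 1 above it forbidden, so the
    row has to be free. The boxes of the new column have nothing to their left and impose no
    condition. *)
Lemma le_diag_add_col :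
  le_diag (add_col p).1 (add_col p).2 =
  le_diag p.1.1 p.1.2 && [forall i, p.2 i ==> free_row p.1.1 p.1.2 i].
Proof.
rewrite /le_diag -!andbA; congr [&& _, _ & _].
- by apply: eq_forallb => i; apply: eq_forallb => i'; rewrite !colE.
- apply/forallP/forallP => H [i j].
    by have := H (i, lift ord0 j); rewrite /= !colE.
  by case: (unliftP ord0 j) => [j'|] -> /=; rewrite !colE ?implybT //; apply: (H (i, j')).
- rewrite -forallb_and; apply: eq_forallb => i.
  rewrite forallb_recl [X in X && _](_ : _ = true) /=; last first.
    apply/implyP => _; rewrite negb_and; apply/orP; right.
    by apply/existsPn => j'.
  have -> : (p.2 i ==> free_row p.1.1 p.1.2 i) =
     [forall j : 'I_m, p.2 i ==> (((j < p.1.1 i)%N && ~~ p.1.2 (i, j)) ==>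
                    ~~ [exists i' : 'I_k, (i' < i)%N && p.1.2 (i', j)])].
    by case: (p.2 i) => //; symmetry; apply/forallP.
  rewrite -forallb_and; apply: eq_forallb => j.
  have -> : [exists i' : 'I_k, (i' < i)%N && (add_col p).2 (i', lift ord0 j)] =
            [exists i' : 'I_k, (i' < i)%N && p.1.2 (i', j)].
    by apply: eq_existsb => i'; rewrite colE.
  have -> : [exists j' : 'I_m.+1, (j' < lift ord0 j)%N && (add_col p).2 (i, j')] =
            p.2 i || [exists j' : 'I_m, (j' < j)%N && p.1.2 (i, j')].
    by rewrite existsb_recl !colE; congr (_ || _); apply: eq_existsb => j'; rewrite !colE.
  rewrite !colE.
  by case: (_ && ~~ _); case: [exists i', _]; case: (p.2 i); case: [exists j', _].
Qed.

Lemma le_rank_add_col :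
  le_rank (add_col p).2 = (le_rank p.1.2 + \sum_(i < k) p.2 i)%N.
Proof.
rewrite !le_rankE -big_split /=; apply: eq_bigr => i _.
rewrite big_ord_recl colE addnC; congr (_ + _)%N.
by apply: eq_bigr => j _; rewrite colE.
Qed.

End AddCol.

(** * The generating function by rank and free rows, and its recursion *)

Section GeneratingFunction.
Context {R : comNzRingType} (u : R).

(** The variable [t] is catalytic: the admissible fillings of a new column depend on the number of
    free rows, so [t = 1] alone gives no closed recursion. *)
Definition le_gf (k m : nat) (t : R) : R :=
  \sum_(p : {ffun 'I_k -> 'I_m.+1} * {ffun 'I_k * 'I_m -> bool} | le_diag p.1 p.2)
     u ^+ le_rank p.2 * t ^+ free_rows p.1 p.2.

Lemma le_gf_row0 k m t :
  \sum_(p : {ffun 'I_k.+1 -> 'I_m.+1} * {ffun 'I_k.+1 * 'I_m -> bool} |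
        le_diag p.1 p.2 && (p.1 ord_max == ord0))
     u ^+ le_rank p.2 * t ^+ free_rows p.1 p.2 = t * le_gf k m t.
Proof.
rewrite (reindex_onto add_row del_row) => [|[lam D] /= /andP[]]; last first.
  case/and3P => _ /forallP HD _ /eqP lam0; rewrite /add_row; congr (_, _); apply/ffunP.
    by move=> i; rewrite ffunE; case: unliftP => [i'|] -> //=; rewrite ffunE.
  case=> i j; rewrite ffunE /=; case: unliftP => [i'|] -> /=; first by rewrite ffunE.
  by have := HD (ord_max, j); rewrite /= lam0 ltn0 implybF => /negbTE ->.
rewrite /le_gf mulr_sumr; apply: eq_big => p.
  by rewrite le_diag_add_row add_row1_max add_rowK !eqxx !andbT.
by move=> _; rewrite le_rank_add_row free_rows_add_row exprS mulrCA.
Qed.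

(* Generating function of the fillings c of a new leftmost column with 1s only
   in the rows of F; [seen] records whether a 1 already occurs above these rows. *)
Definition col_gf (seen : bool) k (F : pred 'I_k) (t : R) : R :=
  \sum_(c : {ffun 'I_k -> bool} | [forall i, c i ==> F i])
     u ^+ (\sum_(i < k) c i) *
     t ^+ (\sum_(i < k)
             (F i && (c i || ~~ (seen || [exists i' : 'I_k, (i' < i)%N && c i'])))).

Lemma le_gf_rowS k m t :
  \sum_(p : {ffun 'I_k.+1 -> 'I_m.+2} * {ffun 'I_k.+1 * 'I_m.+1 -> bool} |
        le_diag p.1 p.2 && (p.1 ord_max != ord0))
     u ^+ le_rank p.2 * t ^+ free_rows p.1 p.2 =
  \sum_(p : {ffun 'I_k.+1 -> 'I_m.+1} * {ffun 'I_k.+1 * 'I_m -> bool} |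
        le_diag p.1 p.2)
     u ^+ le_rank p.2 * col_gf false k.+1 (free_row p.1 p.2) t.
Proof.
rewrite (reindex_onto add_col del_col) => [|[lam D] /= /andP[]]; last first.
  case/and3P => /forallP Hlam _ _ lam0; rewrite /add_col; congr (_, _); apply/ffunP.
    move=> i; rewrite !ffunE /=; case: unliftP => [i'|] // lami /=.
    (* Row lengths decrease, so an empty row [i] would force the last row to be empty. *)
    have /forallP/(_ ord_max) := Hlam i; rewrite -ltnS ltn_ord lami leqn0 /= => lam0'.
    by case/eqP: lam0; apply/val_inj/eqP.
  by case=> i j; rewrite ffunE /=; case: unliftP => [j'|] -> /=; rewrite ffunE.
under [RHS]eq_bigr do rewrite mulr_sumr.
rewrite pair_big_dep; apply: eq_big => p.
  by rewrite le_diag_add_col add_colK eqxx add_col1 eq_sym neq_lift !andbT.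
move=> _; rewrite le_rank_add_col exprD -mulrA free_rowsE; congr (_ * (_ * _ ^+ _)).
by apply: eq_bigr => i _; rewrite row_free_add_col.
Qed.

Definition cons_bit {k} (p : bool * {ffun 'I_k -> bool}) : {ffun 'I_k.+1 -> bool} :=
  [ffun i => if unlift ord0 i is Some i' then p.2 i' else p.1].

Lemma cons_bit0 k (p : bool * {ffun 'I_k -> bool}) : cons_bit p ord0 = p.1.
Proof. by rewrite ffunE unlift_none. Qed.

Lemma cons_bitS k (p : bool * {ffun 'I_k -> bool}) i : cons_bit p (lift ord0 i) = p.2 i.
Proof. by rewrite ffunE liftK. Qed.

Lemma cons_bit_bij k : bijective (@cons_bit k).
Proof.
exists (fun c : {ffun 'I_k.+1 -> bool} => (c ord0, [ffun i => c (lift ord0 i)])) => [[b c]|c].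
  rewrite cons_bit0; congr (_, _); apply/ffunP => i; by rewrite ffunE cons_bitS.
by apply/ffunP => i; case: (unliftP ord0 i) => [i'|] ->;
  rewrite ?cons_bit0 ?cons_bitS ?ffunE.
Qed.

Lemma col_gf0 seen (F : pred 'I_0) t : col_gf seen 0 F t = 1.
Proof.
rewrite /col_gf (eq_bigl predT) => [|c]; last by apply/forallP; case.
rewrite (eq_bigr (fun=> 1)) => [|c _]; last by rewrite !big_ord0 mulr1.
by rewrite sumr_const cardT -cardE card_ffun card_ord expn0.
Qed.

(** Split on the top box. A 0 leaves [seen] unchanged and keeps a free row free only if no 1 lies
    above; a 1 needs a row of [F], contributes [u * t] and sets [seen]. *)
Lemma col_gfS seen k (F : pred 'I_k.+1) t :
  col_gf seen k.+1 F t =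
  t ^+ (F ord0 && ~~ seen) * col_gf seen k (fun i => F (lift ord0 i)) t +
  (F ord0)%:R * (u * t) * col_gf true k (fun i => F (lift ord0 i)) t.
Proof.
pose w (p : bool * {ffun 'I_k -> bool}) :=
  u ^+ (\sum_(i < k.+1) cons_bit p i) *
  t ^+ (\sum_(i < k.+1) (F i && (cons_bit p i || ~~ (seen ||
          [exists i' : 'I_k.+1, (i' < i)%N && cons_bit p i'])))).
have wE b (c : {ffun 'I_k -> bool}) : w (b, c) =
    u ^+ b * u ^+ (\sum_(i < k) c i) *
    (t ^+ (F ord0 && (b || ~~ seen)) *
     t ^+ (\sum_(i < k) (F (lift ord0 i) && (c i || ~~ ((seen || b) ||
             [exists i' : 'I_k, (i' < i)%N && c i']))))).
  rewrite /w !big_ord_recl cons_bit0 -!exprD; congr (u ^+ (_ + _) * t ^+ (_ + _)).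
  - by apply: eq_bigr => i _; rewrite cons_bitS.
  - congr (nat_of_bool (_ && (_ || ~~ _))); case: existsP => [[i /andP[]]//|_].
    by rewrite orbF.
  - apply: eq_bigr => i _; rewrite existsb_recl cons_bit0 cons_bitS orbA;
    congr (nat_of_bool (_ && (_ || ~~ (_ || _)))).
    by apply: eq_existsb => i'; rewrite cons_bitS.
rewrite {1}/col_gf (reindex cons_bit) /=; last exact/onW_bij/cons_bit_bij.
rewrite (eq_bigl (fun p : bool * {ffun 'I_k -> bool} =>
    (p.1 ==> F ord0) && [forall i, p.2 i ==> F (lift ord0 i)])); last first.
  move=> p; rewrite forallb_recl cons_bit0; congr (_ && _).
  by apply: eq_forallb => i; rewrite cons_bitS.
rewrite -(pair_big_dep (fun b => b ==> F ord0)
   (fun _ (c : {ffun 'I_k -> bool}) => [forall i, c i ==> F (lift ord0 i)])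
   (fun b c => w (b, c))) /=.
rewrite big_mkcond /= big_bool /= addrC; congr (_ + _).
  rewrite mulr_sumr; apply: eq_bigr => c _; rewrite wE mul1r orbF; ring.
case: (F ord0) wE => wE; last by rewrite !mul0r.
rewrite mulr_sumr; apply: eq_bigr => c _; rewrite wE /= orbT; ring.
Qed.

(** Below a 1, each row of [F] chooses independently between a 0 (no longer free, weight 1) and a 1
    (still free, weight [u * t]). *)
Lemma col_gf_true k (F : pred 'I_k) t :
  col_gf true k F t = (1 + u * t) ^+ (\sum_(i < k) F i).
Proof.
elim: k F => [|k IHk] F; first by rewrite col_gf0 big_ord0.
by rewrite col_gfS IHk big_ord_recl andbF; case: (F _); rewrite ?exprS /=; ring.
Qed.

(** Summing over the position of the topmost 1 gives a geometric sum: a factor [t] for each row of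
    [F] above it and [1 + u * t] for each one below. The factor [1 + u * t - t] clears its
    denominator. *)
Lemma col_gf_false k (F : pred 'I_k) t :
  (1 + u * t - t) * col_gf false k F t =
  (1 - t) * t ^+ (\sum_(i < k) F i) + u * t * (1 + u * t) ^+ (\sum_(i < k) F i).
Proof.
elim: k F => [|k IHk] F; first by rewrite col_gf0 big_ord0 !expr0; ring.
rewrite col_gfS mulrDr mulrCA IHk col_gf_true big_ord_recl andbT.
by case: (F _); rewrite ?add1n ?add0n ?exprS /=; ring.
Qed.

(** Split on whether the bottom row is empty. In the nonempty case the two powers in [col_gf_false]
    sum to [le_gf] at [t] and at [1 + u * t]. *)
Lemma le_gf_rec k m t :
  (1 + u * t - t) * le_gf k.+1 m.+1 t =
  (1 + u * t - t) * t * le_gf k m.+1 t + (1 - t) * le_gf k.+1 m t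
  + u * t * le_gf k.+1 m (1 + u * t).
Proof.
rewrite {1}/le_gf (bigID (fun p : {ffun 'I_k.+1 -> 'I_m.+2} *
    {ffun 'I_k.+1 * 'I_m.+1 -> bool} => p.1 ord_max == ord0)) /=.
rewrite le_gf_row0 le_gf_rowS.
rewrite mulrDr mulrA -[RHS]addrA; congr (_ + _).
rewrite /le_gf 3!mulr_sumr -big_split /=.
apply: eq_bigr => p _; rewrite mulrCA col_gf_false -free_rowsE.
by move: (u ^+ _) (t ^+ _) ((1 + _) ^+ _) => a b c; ring.
Qed.

Lemma le_gf_empty k t : le_gf k.+1 0 t = t * le_gf k 0 t.
Proof.
rewrite -le_gf_row0; apply: eq_bigl => p.
by rewrite (ord1 (p.1 ord_max)) eqxx andbT.
Qed.

Lemma le_gf0 m t : le_gf 0 m t = 1.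
Proof.
have le_all (p : {ffun 'I_0 -> 'I_m.+1} * {ffun 'I_0 * 'I_m -> bool}) : le_diag p.1 p.2.
  by apply/and3P; split; apply/forallP; [case|case; case|case].
rewrite /le_gf (eq_bigl predT) // (eq_bigr (fun=> 1)) => [|p _]; last first.
  by rewrite le_rankE free_rowsE !big_ord0 mulr1.
rewrite sumr_const cardT -cardE card_prod !card_ffun card_prod !card_ord mul0n !expn0.
by rewrite mulr1n.
Qed.

End GeneratingFunction.

Lemma le_gf1 k n : (k <= n)%N -> Akn k n = le_gf q k (n - k) 1.
Proof. by move=> le_kn; rewrite /Akn le_kn; apply: eq_bigr => p _; rewrite expr1n mulr1. Qed.

(** * Diagonalisation of the recursion *)

Section QIntegers.
Context {F : fieldType} (u : F).
Hypothesis u_neq0 : u != 0.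
Hypothesis u_root : forall n, 1 - u ^+ n.+1 != 0.

Definition qn (n : nat) : F := (1 - u ^+ n) / (1 - u).

Lemma subu_neq0 : 1 - u != 0.
Proof. exact: (u_root 0). Qed.

Lemma uexp_neq0 n : u ^+ n != 0.
Proof. exact/expf_neq0/u_neq0. Qed.

Lemma qnS_neq0 n : qn n.+1 != 0.
Proof. by rewrite mulf_neq0 ?invr_eq0 ?u_root ?subu_neq0. Qed.

Lemma qn0 : qn 0 = 0.
Proof. by rewrite /qn expr0 subrr mul0r. Qed.

Lemma qn1 : qn 1 = 1.
Proof. by rewrite /qn divff ?subu_neq0. Qed.

(** The substitution of [1 + u * t] for [t] sends [[j+1]] to [[j+2]], so the recursion closes on
    these points; [j = 0] is the wanted value [t = 1]. *)
Definition le_poly n j : {poly F} := \poly_(k < n.+1) le_gf u k (n - k) (qn j.+1).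

Lemma le_poly0 j : le_poly 0 j = 1.
Proof.
apply/polyP => k; rewrite coef_poly coef1; case: k => [|k]; first by rewrite le_gf0.
by [].
Qed.

Lemma le_poly_rec n j :
  (u ^+ j.+1)%:P * le_poly n.+1 j =
  ((u ^+ j.+1 * qn j.+1)%:P * 'X - (u * qn j)%:P) * le_poly n j
  + (u * qn j.+1)%:P * le_poly n j.+1.
Proof.
have E1 : 1 + u * qn j.+1 = qn j.+2.
  by rewrite /qn !exprS; field; exact: subu_neq0.
have E2 : 1 + u * qn j.+1 - qn j.+1 = u ^+ j.+1.
  by rewrite E1 /qn !exprS; field; exact: subu_neq0.
have E3 : 1 - qn j.+1 = - (u * qn j).
  by rewrite /qn !exprS; field; exact: subu_neq0.
apply/polyP => k; rewrite mulrBl -mulrA !(coefD, coefN, coefCM, coefXM, coef_poly).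
case: k => [|k] /=; first by rewrite !le_gf0 mulr0 !mulr1 sub0r -E3 -E2; ring.
(* The three cases are the generic recursion, the coefficients beyond the degree, and the rectangle
   of width 0, where [le_gf_empty] replaces [le_gf_rec]. *)
rewrite !ltnS subSS; case: (ltngtP k n) => [lt_kn|lt_nk|->].
- have := le_gf_rec u k (n - k.+1) (qn j.+1).
  rewrite (subnSK lt_kn) E2 E3 E1 => ->; ring.
- by rewrite !mulr0 subr0 addr0.
- by rewrite subnn le_gf_empty; ring.
Qed.

(** Unfolded, this is [u^(-i^2) 'X^i] times the Gaussian binomial of [i+j] over [j] times the
    product of the [1 - u^(l-i) 'X] for [l < j]. *)
Fixpoint eig (i j : nat) : {poly F} :=
  if j is j'.+1 then
    (qn (i + j').+1 / qn j'.+1)%:P * (1 - (u ^+ j' / u ^+ i)%:P * 'X) * eig i j'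
  else (u ^- (i * i))%:P * 'X^i.

(* eig, eigval and eigw are E_i, lam_i and (1 - y q^(-2i-1)) E_i of the header. *)
Definition eigval (i : nat) : {poly F} := (qn i.+1)%:P - (qn i / u ^+ i)%:P * 'X.

Definition eigw (i j : nat) : {poly F} := (1 - (u ^- (2 * i + 1))%:P * 'X) * eig i j.

Lemma eigS i j : eig i j.+1 =
    (qn (i + j).+1 / qn j.+1)%:P * (1 - (u ^+ j / u ^+ i)%:P * 'X) * eig i j.
Proof. by []. Qed.

Lemma eig0 i : eig i 0 = (u ^- (i * i))%:P * 'X^i.
Proof. by []. Qed.

(** The recursion defining [eig] is this equation solved for [eig i j.+1]. Comparing the
    coefficients of [1] and ['X] in front of [eig i j] leaves two identities between q-integers. *)
Lemma eig_eigval i j :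
  (u ^+ j.+1)%:P * eigval i * eig i j =
  ((u ^+ j.+1 * qn j.+1)%:P * 'X - (u * qn j)%:P) * eig i j
  + (u * qn j.+1)%:P * eig i j.+1.
Proof.
rewrite eigS /eigval; set c := qn (i + j).+1 / qn j.+1; set d := u ^+ j / u ^+ i.
rewrite [LHS](_ : _ = ((u ^+ j.+1 * qn i.+1)%:P - (u ^+ j.+1 * (qn i / u ^+ i))%:P * 'X) * eig i j);
  last by ring.
have Ec : u * qn j.+1 * c = u * qn (i + j).+1 by rewrite -mulrA [qn _ * c]mulrC divfK ?qnS_neq0.
have -> : u ^+ j.+1 * qn i.+1 = - (u * qn j) + u * qn j.+1 * c.
  by rewrite Ec /qn !exprS exprD; field; exact: subu_neq0.
have -> : u ^+ j.+1 * (qn i / u ^+ i) = - (u ^+ j.+1 * qn j.+1) + u * qn j.+1 * c * d.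
  rewrite Ec /d /qn !exprS exprD; field.
  by rewrite subu_neq0 uexp_neq0.
by ring.
Qed.

(** The extra factor of [eigw] does not depend on [j], so the eigenvalue equation survives. *)
Lemma eigw_eigval i j :
  (u ^+ j.+1)%:P * eigval i * eigw i j =
  ((u ^+ j.+1 * qn j.+1)%:P * 'X - (u * qn j)%:P) * eigw i j
  + (u * qn j.+1)%:P * eigw i j.+1.
Proof. by rewrite /eigw mulrCA eig_eigval; ring. Qed.

(** The products in [eig i.+1 j] and [eig i j] run over windows of exponents shifted by one, so they
    differ only in their end factors. *)
Lemma eig_shift i j :
  (qn i.+1)%:P * (1 - (u ^+ j / u ^+ i.+1)%:P * 'X) * eig i.+1 j =
  (qn (i + j).+1 / u ^+ (2 * i + 1))%:P * 'X * (1 - (u ^- i.+1)%:P * 'X) * eig i j.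
Proof.
elim: j => [|j IHj].
  rewrite addn0 expr0 mul1r !eig0 (exprS 'X i).
  have -> : u ^- (i.+1 * i.+1) = u ^- (2 * i + 1) * u ^- (i * i).
    by rewrite -invfM -exprD; congr (u ^- _); lia.
  by move: (u ^- (2 * i + 1)) (u ^- (i * i)) (u ^- i.+1) => a b c; ring.
rewrite eigS; set P := (1 - (u ^+ j / u ^+ i.+1)%:P * 'X) in IHj *.
rewrite [LHS](_ : _ = (1 - (u ^+ j.+1 / u ^+ i.+1)%:P * 'X) *
  (qn (i.+1 + j).+1 / qn j.+1)%:P * ((qn i.+1)%:P * P * eig i.+1 j)); last by ring.
have -> : u ^+ j.+1 / u ^+ i.+1 = u ^+ j / u ^+ i.
  by rewrite !exprSr; field; rewrite u_neq0 uexp_neq0.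
by rewrite IHj eigS addSn (addnS i j); ring.
Qed.

(** The potential for the telescoping in [i]: it vanishes at [i = 0] because [[0] = 0], and it is
    divisible by ['X^i]. *)
Definition eig_tele (i j : nat) : {poly F} :=
  (u ^+ j.+1 / qn j.+1)%:P * ((qn i)%:P * (1 - (u ^+ j / u ^+ i)%:P * 'X) * eig i j).

(** By [eig_shift] all four terms are multiples of [eig i j]; the coefficients of [1], ['X] and
    ['X^2] are then compared. *)
Lemma eigw_tele i j : eigw i j.+1 - eigw i j = eig_tele i j - eig_tele i.+1 j.
Proof.
rewrite /eig_tele eig_shift /eigw eigS.
set A := u ^+ j.+1 / qn j.+1; set c := qn (i + j).+1 / qn j.+1; set d := u ^+ j / u ^+ i.
set e := u ^- (2 * i + 1); set g := qn (i + j).+1 / u ^+ (2 * i + 1); set f := u ^- i.+1.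
rewrite [LHS](_ : _ = ((c - 1)%:P - (c * d + c * e - e)%:P * 'X + (c * d * e)%:P * 'X^2) * eig i j);
  last by ring.
have side : [&& 1 - u ^+ j * u != 0, 1 - u != 0, u ^+ i != 0 & u != 0].
  by rewrite -exprSr u_root subu_neq0 uexp_neq0 u_neq0.
have -> : c - 1 = A * qn i.
  rewrite /c /A /qn !exprSr exprD; field;
  case/and4P: side => H1 H2 H3 H4; rewrite ?H1 ?H2 ?H3 ?H4 ?andbT //.
have -> : c * d + c * e - e = A * qn i * d + A * g.
  rewrite /c /A /e /g /d /qn mul2n -addnn addn1 !exprSr !exprD; field;
  case/and4P: side => H1 H2 H3 H4; rewrite ?H1 ?H2 ?H3 ?H4 ?andbT //.
have -> : c * d * e = A * g * f.
  rewrite /c /A /e /g /d /f /qn mul2n -addnn addn1 !exprSr !exprD; field;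
  case/and4P: side => H1 H2 H3 H4; rewrite ?H1 ?H2 ?H3 ?H4 ?andbT //.
by ring.
Qed.

Lemma eig_dvd i j : exists r, eig i j = r * 'X^i.
Proof.
elim: j => [|j [r IHj]]; first by eexists.
by rewrite eigS IHj mulrA; eexists.
Qed.

(** Induction on [j]. At [j = 0] the sum telescopes by itself; passing from [j] to [j.+1] changes it
    by [- eig_tele N j], a multiple of ['X^N]. *)
Lemma sum_eigw N j : exists r, \sum_(i < N) eigw i j = 1 + r * 'X^N.
Proof.
elim: j => [|j [r IHj]].
  exists (- (u ^- (N * N))%:P); rewrite mulNr.
  elim: N => [|N IHN]; first by rewrite big_ord0 expr0 invr1 mulr1 subrr.
  rewrite big_ord_recr /= IHN /eigw /= -addrA; congr (_ + _).
  rewrite mulrBl mul1r addrA addNr add0r exprS.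
  rewrite (_ : u ^- (N.+1 * N.+1) = u ^- (2 * N + 1) * u ^- (N * N)); last first.
    by rewrite -invfM -exprD; congr (u ^- _); lia.
  by rewrite polyCM; ring.
have [s Es] := eig_dvd N j.
exists (r - (u ^+ j.+1 / qn j.+1)%:P * ((qn N)%:P * (1 - (u ^+ j / u ^+ N)%:P * 'X) * s)).
have : \sum_(i < N) (eigw i j.+1 - eigw i j) = eig_tele 0 j - eig_tele N j.
  under eq_bigr do rewrite eigw_tele -opprB.
  rewrite -(big_mkord xpredT (fun i => - (eig_tele i.+1 j - eig_tele i j))) sumrN.
  by rewrite telescope_sumr // opprB.
rewrite sumrB IHj => /(canRL (subrK _)) ->.
by rewrite /eig_tele Es qn0; ring.
Qed.

(** Working modulo ['X^N] for arbitrary [N] replaces an infinite eigenfunction expansion. The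
    recursion operator has polynomial coefficients, so it preserves divisibility of the remainder by
    ['X^N]. *)
Lemma le_poly_eig N n j :
  exists r, le_poly n j = \sum_(i < N) eigval i ^+ n * eigw i j + r * 'X^N.
Proof.
elim: n j => [|n IHn] j.
  have [r Er] := sum_eigw N j; exists (- r); rewrite le_poly0.
  by under eq_bigr do rewrite expr0 mul1r; rewrite Er; ring.
have [r0 E0] := IHn j; have [r1 E1] := IHn j.+1.
set a := (u ^+ j.+1 * qn j.+1)%:P * 'X - (u * qn j)%:P; set b := (u * qn j.+1)%:P.
exists ((u ^- j.+1)%:P * (a * r0 + b * r1)).
have c_neq0 : (u ^+ j.+1)%:P != 0 :> {poly F} by rewrite polyC_eq0 uexp_neq0.
have step : (u ^+ j.+1)%:P * (\sum_(i < N) eigval i ^+ n.+1 * eigw i j) =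
    a * (\sum_(i < N) eigval i ^+ n * eigw i j) +
    b * (\sum_(i < N) eigval i ^+ n * eigw i j.+1).
  rewrite !mulr_sumr -big_split; apply: eq_bigr => i _ /=.
  have := eigw_eigval i j; rewrite -/a -/b => E.
  rewrite [LHS](_ : _ = eigval i ^+ n * ((u ^+ j.+1)%:P * eigval i * eigw i j)).
    by rewrite E; ring.
  by rewrite (exprS (eigval i)); ring.
apply: (mulfI c_neq0); rewrite le_poly_rec E0 E1 -/a -/b [RHS]mulrDr step.
rewrite [X in _ = _ + X](_ : _ =
    (u ^+ j.+1 * u ^- j.+1)%:P * ((a * r0 + b * r1) * 'X^N)); last by ring.
by rewrite divff ?uexp_neq0 //; ring.
Qed.

(** * Coefficient extraction at [j = 0] *)

Lemma le_poly_eig0_coef k n :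
  (le_poly n 0)`_k =
  \sum_(i < k.+1) ((eigval i ^+ n)`_(k - i) / u ^+ (i * i)
      - (if i == k :> nat then 0 else (eigval i ^+ n)`_(k - i.+1) / u ^+ (i.+1 * i.+1))).
Proof.
(* With [N = k + 1] the remainder does not reach the coefficient [k]. *)
have [r ->] := le_poly_eig k.+1 n 0.
rewrite coefD coefMXn ltnSn addr0 coef_sum; apply: eq_bigr => i _.
have -> : eigval i ^+ n * eigw i 0 = eigval i ^+ n * (u ^- (i * i))%:P * 'X^i -
    eigval i ^+ n * (u ^- (i.+1 * i.+1))%:P * 'X^(i.+1).
  rewrite /eigw eig0 (_ : u ^- (i.+1 * i.+1) = u ^- (2 * i + 1) * u ^- (i * i)).
    by rewrite polyCM (exprS 'X i); ring.
  by rewrite -invfM -exprD; congr (u ^- _); lia.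
have le_ik : (i <= k)%N by rewrite -ltnS.
(* For [i = k] the second term starts at ['X^(k+1)] and contributes 0, although the truncated
   [k - i.+1] would point to its constant coefficient; hence the [if]. *)
rewrite coefB !coefMXn !coefMC ltnS (leq_eqVlt k) (ltnNge k) le_ik orbF (eq_sym (i : nat)).
by case: eqP.
Qed.

Lemma eigval_coef i n j :
  (eigval i ^+ n)`_j = 'C(n, j)%:R * qn i.+1 ^+ (n - j) * (- (qn i / u ^+ i)) ^+ j.
Proof.
rewrite /eigval exprDn coef_sum.
under eq_bigr => l _.
  rewrite -mulNr -polyCN exprMn -!rmorphXn /= mulrA -polyCM coefMn coefCM coefXn; over.
case: (ltnP j n.+1) => [lt_jn|le_nj]; last first.
  rewrite bin_small // !mul0r big1 // => l _; rewrite gtn_eqF ?mulr0 ?mul0rn //.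
  exact: leq_trans (ltn_ord l) _.
rewrite (bigD1 (Ordinal lt_jn)) //= eqxx mulr1 big1 ?addr0 => [|l neq_lj].
  by rewrite -mulrA mulr_natl.
by rewrite (_ : (j == l) = false) ?mulr0 ?mul0rn // eq_sym; apply/negbTE.
Qed.

Lemma eigval0_coef n j : (eigval 0 ^+ n)`_j = (j == 0)%:R.
Proof.
rewrite eigval_coef qn0 qn1 mul0r oppr0 expr1n mulr1 expr0n.
by case: j => [|j]; rewrite ?bin0 ?mulr1 ?mulr0.
Qed.

(** The eigenvalue for [i = 0] is 1, so that summand has a constant contribution; it becomes the
    isolated term [-y/(q(1-x))] of the series. *)
Lemma le_poly_coefS k n :
  (le_poly n 0)`_k.+1 = - u^-1 * (k.+1 == 1)%:R +
  \sum_(i < k.+1) ((eigval i.+1 ^+ n)`_(k.+1 - i.+1) / u ^+ (i.+1 * i.+1)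
    - (if (i.+1 < k.+1)%N then (eigval i.+1 ^+ n)`_(k.+1 - i.+2) / u ^+ (i.+2 * i.+2) else 0)).
Proof.
rewrite le_poly_eig0_coef big_ord_recl /= !eigval0_coef subn0 mul0r sub0r subn1 /= expr1.
congr (_ + _); first by rewrite mulrC mulNr; case: k.
apply: eq_bigr => i _; rewrite /bump /= add1n; congr (_ - _).
by rewrite ltn_neqAle ltn_ord andbT; case: eqP.
Qed.

(** The second part of summand [i] carries the same power of [u] as the first part of summand [i+1];
    these are paired and the order of summation is reversed. *)
Lemma le_poly_coef_rev k n : (0 < k)%N ->
  (le_poly n 0)`_k =
  \sum_(i < k) ((eigval (k - i) ^+ n)`_i - (eigval (k - i).-1 ^+ n)`_i) / u ^+ ((k - i) * (k - i)).
Proof.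
move=> k_gt0; rewrite le_poly_eig0_coef sumrB.
rewrite big_ord_recl eigval0_coef subn0 eqn0Ngt k_gt0 mul0r add0r.
rewrite [X in _ - X]big_ord_recr /= eqxx addr0.
rewrite [X in _ - X](eq_bigr (fun i : 'I_k => (eigval i ^+ n)`_(k - i.+1) / u ^+ (i.+1 * i.+1))); last first.
  by move=> i _; rewrite ltn_eqF.
rewrite -sumrB (reindex_inj rev_ord_inj); apply: eq_bigr => i _ /=.
have lt_ik := ltn_ord i; have E : (k - i.+1).+1 = (k - i)%N by rewrite subnSK.
by rewrite /bump /= add1n E subKn ?mulrBl 1?ltnW // -E.
Qed.

Lemma le_poly_coef_explicit k n : (0 < k)%N ->
  (le_poly n 0)`_k =
  \sum_(i < k) 'C(n, i)%:R * u ^- ((k - i) * (k - i)) *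
    ((- (qn (k - i) / u ^+ (k - i))) ^+ i * qn (k - i).+1 ^+ (n - i)
     - (- (qn (k - i).-1 / u ^+ (k - i).-1)) ^+ i * qn (k - i) ^+ (n - i)).
Proof.
move=> k_gt0; rewrite le_poly_coef_rev //; apply: eq_bigr => i _.
by rewrite !eigval_coef prednK ?subn_gt0 //; ring.
Qed.

Lemma le_poly_coef_explicit_pos k n : (0 < k)%N ->
  (le_poly n 0)`_k =
  u ^- (k * k) * \sum_(i < k) (-1) ^+ i * 'C(n, i)%:R *
    (u ^+ (k * i) * qn (k - i) ^+ i * qn (k - i).+1 ^+ (n - i)
     - u ^+ ((k + 1) * i) * qn (k - i).-1 ^+ i * qn (k - i) ^+ (n - i)).
Proof.
move=> k_gt0; rewrite le_poly_coef_explicit // mulr_sumr; apply: eq_bigr => i _.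
have lt_ik := ltn_ord i.
have [m Em] : exists m, (k - i)%N = m.+1 by exists (k - i.+1)%N; rewrite subnSK.
rewrite Em /= !(exprNn (_ / _)) (expr_div_n (qn m.+1)) (expr_div_n (qn m)) -!exprM.
have ratio x y z : (x + y)%N = z -> u ^- z * u ^+ x = u ^- y.
  by move=> <-; rewrite exprD invfM mulrAC mulVf ?mul1r ?uexp_neq0.
(* The exponents agree because [k^2 - k i = (k-i) i + (k-i)^2] and, for [E2],
   [k^2 - (k+1) i = (k-i-1) i + (k-i)^2]. *)
have E1 : u ^- (k * k) * u ^+ (k * i) = u ^- (m.+1 * i) * u ^- (m.+1 * m.+1).
  by rewrite -invfM -exprD; apply: ratio; move: Em lt_ik; nia.
have E2 : u ^- (k * k) * u ^+ ((k + 1) * i) = u ^- (m * i) * u ^- (m.+1 * m.+1).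
  by rewrite -invfM -exprD; apply: ratio; move: Em lt_ik; nia.
move: E1 E2.
move: (u ^- (k * k)) (u ^+ (k * i)) (u ^+ ((k + 1) * i)) (u ^- (m.+1 * i)) (u ^- (m * i)).
move: (u ^- (m.+1 * m.+1)) ((-1) ^+ i) => a s b c d e f E1 E2.
rewrite [LHS](_ : _ = s * 'C(n, i)%:R * ((e * a) * (qn m.+1 ^+ i * qn m.+2 ^+ (n - i))
  - (f * a) * (qn m ^+ i * qn m.+1 ^+ (n - i)))); last by ring.
by rewrite -E1 -E2; ring.
Qed.

Lemma qnN n : (1 - u ^- n) / (1 - u) = - (qn n / u ^+ n).
Proof. by rewrite /qn; field; rewrite subu_neq0 uexp_neq0. Qed.

Lemma eigval_coefS i n j :
  (eigval i ^+ n.+1)`_j =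
  qn i.+1 * (eigval i ^+ n)`_j - qn i / u ^+ i * (if j is j'.+1 then (eigval i ^+ n)`_j' else 0).
Proof.
rewrite exprS {1}/eigval mulrBl coefB -(mulrA _ 'X) !coefCM coefXM.
by case: j.
Qed.

End QIntegers.

(** * Power series *)

Lemma eq_psmul (f f' g g' : ps) :
  (forall a b, f a b = f' a b) -> (forall a b, g a b = g' a b) ->
  forall a b, psmul f g a b = psmul f' g' a b.
Proof.
by move=> Ef Eg a b; apply: eq_bigr => i _; apply: eq_bigr => j _; rewrite Ef Eg.
Qed.

Lemma psmul_addl (f g h : ps) a b : psmul (psadd f g) h a b = psmul f h a b + psmul g h a b.
Proof.
rewrite -big_split; apply: eq_bigr => i _ /=; rewrite -big_split.
by apply: eq_bigr => j _; rewrite /psadd mulrDl.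
Qed.

Lemma psmul_mon c a0 b0 (h : ps) a b :
  psmul (psmon c a0 b0) h a b =
  if (a0 <= a)%N && (b0 <= b)%N then c * h (a - a0)%N (b - b0)%N else 0.
Proof.
rewrite /psmul /psmon; case: ifP => [/andP[le_a le_b]|out].
  rewrite (bigD1 (Ordinal (le_a : (a0 < a.+1)%N))) //= [X in _ + X]big1 ?addr0 => [|i neq_i].
    rewrite (bigD1 (Ordinal (le_b : (b0 < b.+1)%N))) //= !eqxx [X in _ + X]big1 ?addr0 // => j neq_j.
    by rewrite (_ : (j == b0 :> nat) = false) ?mul0r //; apply/negbTE.
  apply: big1 => j _.
  by rewrite (_ : (i == a0 :> nat) = false) ?mul0r //; apply/negbTE.
apply: big1 => i _; apply: big1 => j _; case: ifP => [/andP[/eqP Ei /eqP Ej]|_]; last by rewrite mul0r.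
by move: out; rewrite -Ei -Ej (leq_ord i) (leq_ord j).
Qed.

(** Isolating the [(0,0)] term of the convolution expresses [g a b] by values of smaller total
    degree, as in [inv_aux]. The induction covers any fuel [N >= a + b], since recursive calls may
    lower the degree by more than one. *)
Lemma psinv_unique (f g : ps) :
  f 0 0 != 0 -> (forall a b, psmul f g a b = psmon 1 0 0 a b) ->
  forall a b, psinv f a b = g a b.
Proof.
move=> f00 fg1; suff H N : forall a b, (a + b <= N)%N -> inv_aux f N a b = g a b.
  by move=> a b; apply: H.
have E a b : f 0 0 * g a b + \sum_(i < a.+1) \sum_(j < b.+1)
     (if (i + j == 0)%N then 0 else f i j * g (a - i)%N (b - j)%N) = psmon 1 0 0 a b.
  rewrite -fg1 /psmul !big_ord_recl /= add0r !subn0 -!addrA; congr (_ + (_ + _)).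
have g00 : g 0 0 = (f 0 0)^-1.
  have := E 0 0; rewrite !big_ord1 /= addr0 /psmon /= => E0.
  by rewrite -[RHS]mulr1 -E0 mulKf.
elim: N => [|N IHN] a b /=.
  by rewrite leqn0 addn_eq0 => /andP[/eqP-> /eqP->].
move=> le_ab; case: ifP => [|ab_neq0].
  by rewrite addn_eq0 => /andP[/eqP-> /eqP->].
have := E a b; rewrite /psmon -addn_eq0 ab_neq0 => /(canRL (addrK _)).
rewrite sub0r => /(canRL (mulKf f00)) ->; rewrite mulNr mulrN; congr (- (_ * _)).
apply: eq_bigr => i _; apply: eq_bigr => j _; case: ifP => // ij_neq0; congr (_ * _).
by apply: IHN; have := ltn_ord i; have := ltn_ord j; lia.
Qed.

(** * Specialisation to [q], which is nonzero and not a root of unity *)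

Lemma q_neq0 : q != 0.
Proof. by rewrite tofrac_eq0 polyX_eq0. Qed.

Lemma q_root n : 1 - q ^+ n.+1 != 0.
Proof.
rewrite -tofracXn -tofrac1 -tofracB tofrac_eq0 subr_eq0 eq_sym.
apply/eqP => /(congr1 (fun p : {poly int} => size p)).
by rewrite size_polyXn size_poly1.
Qed.

Lemma qint_nat n : qint n%:Z = qn q n.
Proof. by []. Qed.

Lemma qint_opp n : qint (- n%:Z) = - (qn q n / q ^+ n).
Proof. by rewrite -(qnN q q_neq0 q_root) /qint exprnN. Qed.

Lemma Akn_coef k n : Akn k n = (le_poly q n 0)`_k.
Proof.
rewrite coef_poly ltnS (qn1 q q_root); case: leqP => [le_kn|lt_nk]; first by rewrite le_gf1.
by rewrite /Akn leqNgt lt_nk.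
Qed.

Lemma qexp_neq0 n : q ^+ n != 0.
Proof. exact: (uexp_neq0 q q_neq0). Qed.

Lemma qexp_ratio x y z : (x + y)%N = z -> q ^- z * q ^+ x = q ^- y.
Proof. by move=> <-; rewrite exprD invfM mulrAC mulVf ?mul1r ?qexp_neq0. Qed.

(** * Inverses of the denominators *)

Lemma psinv_one_sub_x a b :
  psinv (psadd (psmon 1 0 0) (psmon (-1) 1 0)) a b = (b == 0)%:R.
Proof.
apply: (psinv_unique _ (fun _ b' => (b' == 0)%:R)) => [|{}a {}b].
  by rewrite /psadd /psmon /= addr0 oner_eq0.
rewrite psmul_addl !psmul_mon /psmon !subn0 leq0n !andbT mul1r mulN1r.
by case: a => [|a]; case: b => [|b]; rewrite /= ?addr0 ?subrr ?oppr0 ?addr0.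
Qed.

(** The denominator is [q^i (1 - x eigval_i(y))], so its inverse is a geometric series in [x]. *)
Lemma psinv_gf_denominator i a b :
  psinv (psadd (psmon (q ^+ i) 0 0)
           (psadd (psmon (- (q ^+ i * qint (i.+1)%:Z)) 1 0) (psmon (qint i%:Z) 1 1))) a b =
  q ^- i * (eigval q i ^+ a)`_b.
Proof.
apply: (psinv_unique _ (fun a' b' => q ^- i * (eigval q i ^+ a')`_b')) => [|{}a {}b].
  by rewrite /psadd /psmon /= !addr0 qexp_neq0.
rewrite !psmul_addl !psmul_mon /psmon !subn0 leq0n !andbT !qint_nat.
case: a => [|a] /=.
  by rewrite expr0 coef1 !addr0 mulVKf ?qexp_neq0 //; case: eqP.
have qi_neq0 := qexp_neq0 i.
rewrite subn1 /= eigval_coefS mulVKf //.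
have cancel (F : fieldType) (c x y u v : F) : c != 0 ->
    x * u - y / c * v + (- (c * x) * (c^-1 * u) + y * (c^-1 * v)) = 0 by move=> c_neq0; field.
rewrite -[RHS](cancel K (q ^+ i) (qn q i.+1) (qn q i) (eigval q i ^+ a)`_b
  (if b is b'.+1 then (eigval q i ^+ a)`_b' else 0) qi_neq0).
by case: b => [|b]; rewrite ?subn1 /= ?mulr0.
Qed.

(* The series (1 - c x)^(-m). *)
Definition neg_binomial (c : K) (m : nat) : ps :=
  fun a b => if b == 0%N then 'C((a + m).-1, a)%:R * c ^+ a else 0.

Lemma psmul_one_minus i (h : ps) a b :
  psmul (one_minus i) h a b =
  h a b - qint i.+1%:Z * (if a is a'.+1 then h a' b else 0).
Proof.
rewrite psmul_addl !psmul_mon !subn0 mul1r leq0n andbT /=; congr (_ + _).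
by case: a => [|a]; rewrite ?mulr0 ?oppr0 //= subn1 mulNr.
Qed.

(** A factor linear in [x] moves across a product because multiplication by [x] is a shift that
    either factor can absorb. *)
Lemma psmul_one_minus_mul i (f g : ps) a b :
  psmul (psmul (one_minus i) f) g a b = psmul f (psmul (one_minus i) g) a b.
Proof.
set c := qint i.+1%:Z; pose prev (h : ps) : ps := fun a b => if a is a'.+1 then h a' b else 0.
have shift : \sum_(l < a.+1) \sum_(j < b.+1) prev f l j * g (a - l)%N (b - j)%N =
             \sum_(l < a.+1) \sum_(j < b.+1) f l j * prev g (a - l)%N (b - j)%N.
  rewrite big_ord_recl [RHS]big_ord_recr /= subnn.
  rewrite [X in X + _]big1 ?[X in _ = _ + X]big1 ?add0r ?addr0 => [|j _|j _];
    rewrite ?mul0r ?mulr0 //.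
  by apply: eq_bigr => l _; apply: eq_bigr => j _; rewrite /bump add1n -(subnSK (ltn_ord l)).
have splitl : psmul (psmul (one_minus i) f) g a b =
    psmul f g a b - c * \sum_(l < a.+1) \sum_(j < b.+1) prev f l j * g (a - l)%N (b - j)%N.
  rewrite mulr_sumr -sumrB; apply: eq_bigr => l _; rewrite mulr_sumr -sumrB.
  by apply: eq_bigr => j _; rewrite psmul_one_minus mulrBl mulrA.
rewrite splitl shift mulr_sumr -sumrB; apply: eq_bigr => l _; rewrite mulr_sumr -sumrB.
by apply: eq_bigr => j _; rewrite psmul_one_minus mulrBr mulrCA.
Qed.

Lemma psmul_one_minus_neg_binomial i m a b :
  psmul (one_minus i) (neg_binomial (qint i.+1%:Z) m.+1) a b =
  neg_binomial (qint i.+1%:Z) m a b.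
Proof.
rewrite psmul_one_minus /neg_binomial; move: (qint _) => c.
case: (b == 0%N); last by case: a => [|a]; rewrite mulr0 subr0.
case: a => [|a]; first by rewrite mulr0 subr0 !bin0.
(* Pascal's rule. *)
rewrite !addnS !addSn /= exprS binS natrD; ring.
Qed.

(** The linear factors are moved one by one onto the binomial series, each lowering its exponent by
    one. *)
Lemma psinv_pow_one_minus i m a b :
  psinv (pspow (one_minus i) m) a b = neg_binomial (qint i.+1%:Z) m a b.
Proof.
apply: psinv_unique => [|{}a {}b].
  elim: m => [|m IHm] /=; first by rewrite /psmon /= oner_eq0.
  by rewrite psmul_one_minus mulr0 subr0.
elim: m a b => [|m IHm] a b.
  rewrite psmul_mon !subn0 mul1r /= /neg_binomial /psmon addn0.
  case: a => [|a]; first by rewrite bin0 mulr1; case: eqP.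
  by rewrite bin_small // mul0r; case: ifP.
rewrite psmul_one_minus_mul -IHm; apply: eq_psmul => // a' b'.
exact: psmul_one_minus_neg_binomial.
Qed.

(** * Coefficients of the terms in the stated series *)

Lemma gf_firstE a b : gf_first a b = - q^-1 * (b == 1)%:R.
Proof.
rewrite /gf_first /psscale psmul_mon leq0n /= mul1r psinv_one_sub_x.
by case: b => [|[|b]].
Qed.

(** The numerator [y^i (q^(2i+1) - y)] gives the difference; the powers of [q] combine to [i^2] and
    [(i+1)^2]. *)
Lemma gf_termE i a b :
  gf_term i a b =
  (if (i <= b)%N then (eigval q i ^+ a)`_(b - i) / q ^+ (i * i) else 0) -
  (if (i < b)%N then (eigval q i ^+ a)`_(b - i.+1) / q ^+ (i.+1 * i.+1) else 0).
Proof.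
rewrite /gf_term /psscale psmul_addl !psmul_mon !leq0n !subn0 !psinv_gf_denominator /=.
have Ee : q ^- (i.+1 * i.+1) = q ^- (i * i + i + 1) * q ^- i.
  by rewrite -invfM -exprD; congr (q ^- _); lia.
have Ei : q ^- (i * i) = q ^- (i.+1 * i.+1) * q ^+ (2 * i + 1) by rewrite (@qexp_ratio _ (i * i)) //; lia.
rewrite Ei Ee; move: (q ^- (i * i + i + 1)) (q ^- i) (q ^+ (2 * i + 1)) => x y z.
by do 2![case: ifP => _]; ring.
Qed.

(** Both sides are [C(a,m) [i]^m [i+1]^(a-m)]: the left by the symmetry of binomials, the right
    because sign and power of [q] cancel those in [eigval_coef]. *)
Lemma neg_binomial_eigval i m a :
  (if (m <= a)%N then qint i%:Z ^+ m * neg_binomial (qint i.+1%:Z) m.+1 (a - m)%N 0%N else 0) =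
  (-1) ^+ m * q ^+ (i * m) * (eigval q i ^+ a)`_m.
Proof.
rewrite eigval_coef; case: leqP => [le_ma|lt_am]; last by rewrite bin_small // !mul0r mulr0.
rewrite /neg_binomial eqxx addnS subnK //= bin_sub // !qint_nat (exprNn (_ / _)) (expr_div_n (qn q i)) -exprM.
have := qexp_neq0 (i * m); move: (q ^+ (i * m)) => t t_neq0.
have := sqrr_sign K m; rewrite expr2; move: ((-1) ^+ m) => s ss1.
move: (qn q i ^+ m) (qn q i.+1 ^+ _) ('C(a, m)%:R) => x y z.
rewrite [RHS](_ : _ = (s * s) * (t / t) * (x * (z * y))); last by ring.
by rewrite ss1 divff // !mul1r.
Qed.

Lemma Ak_term1E k i a : (i < k)%N ->
  Ak_term1 k i a 0%N = - ((eigval q i ^+ a)`_(k - i.+1) / q ^+ (i.+1 * i.+1)).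
Proof.
move=> lt_ik; rewrite /Ak_term1 /psscale psmul_mon leq0n andbT subn0 psinv_pow_one_minus.
rewrite -subnDA (addn1 i) -(subnSK lt_ik) neg_binomial_eigval.
have -> : (i + k)%N = (i * 2 + (k - i.+1)).+1 by lia.
rewrite exprS exprD exprM sqrr_sign mul1r.
(* Here [(k i + i + 1) - i (k-i-1) = (i+1)^2]. *)
have -> : q ^- (i.+1 * i.+1) = q ^- (k * i + i + 1) * q ^+ (i * (k - i.+1)).
  by rewrite (@qexp_ratio _ (i.+1 * i.+1)) //; move: lt_ik; nia.
have := sqrr_sign K (k - i.+1); rewrite expr2; move: ((-1) ^+ (k - i.+1)) => s ss1.
move: (q ^- _) (q ^+ (i * _)) (_`_(k - i.+1)) => x y z.
rewrite [LHS](_ : _ = - (s * s * (z * (x * y)))); last by ring.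
by rewrite ss1 mul1r.
Qed.

Lemma Ak_term2E k i a : (i <= k)%N ->
  Ak_term2 k i a 0%N = (eigval q i ^+ a)`_(k - i) / q ^+ (i * i).
Proof.
move=> le_ik; rewrite /Ak_term2 /psscale psmul_mon leq0n andbT subn0 psinv_pow_one_minus.
rewrite neg_binomial_eigval.
have -> : (i + k)%N = (i * 2 + (k - i))%N by lia.
rewrite exprD exprM sqrr_sign mul1r.
have -> : q ^- (i * i) = q ^- (k * i) * q ^+ (i * (k - i)).
  by rewrite (@qexp_ratio _ (i * i)) //; move: le_ik; nia.
have := sqrr_sign K (k - i); rewrite expr2; move: ((-1) ^+ (k - i)) => s ss1.
move: (q ^- _) (q ^+ (i * _)) (_`_(k - i)) => x y z.
rewrite [LHS](_ : _ = s * s * (z * (x * y))); last by ring.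
by rewrite ss1 mul1r.
Qed.

(** * Closed formulas for the coefficients and the series *)

Lemma Akn_explicit k n : (0 < k)%N ->
  Akn k n = \sum_(i < k) (('C(n, i))%:R * q ^ (- ((k%:Z - i%:Z) ^+ 2)) *
    (qint (i%:Z - k%:Z) ^+ i * qint (k%:Z - i%:Z + 1) ^ (n%:Z - i%:Z)
     - qint (i%:Z - k%:Z + 1) ^+ i * qint (k%:Z - i%:Z) ^ (n%:Z - i%:Z))).
Proof.
move=> k_gt0; rewrite Akn_coef (le_poly_coef_explicit q q_neq0 q_root _ _ k_gt0).
apply: eq_bigr => i _.
(* For [i > n] the exponent [n - i] is negative, but the binomial coefficient is 0. *)
case: (leqP i n) => [le_in|lt_ni]; last by rewrite bin_small // !mul0r.
have [m Em] : exists m, (k - i)%N = m.+1 by exists (k - i.+1)%N; rewrite subnSK.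
have -> : k%:Z - i%:Z = m.+1%:Z by rewrite -Em subzn // ltnW.
have -> : i%:Z - k%:Z = - m.+1%:Z by rewrite -Em -subzn 1?ltnW // opprB.
have -> : - m.+1%:Z + 1 = - m%:Z by lia.
have -> : m.+1%:Z + 1 = m.+2%:Z by lia.
have -> : m.+1%:Z ^+ 2 = (m.+1 * m.+1)%N by rewrite expr2.
by rewrite (subzn le_in) Em (qint_opp m.+1) (qint_opp m) -exprnN.
Qed.

Lemma Akn_explicit_pos k n : (0 < k)%N ->
  Akn k n = q ^- (k * k) *
    \sum_(i < k) ((-1) ^+ i * ('C(n, i))%:R *
      (q ^+ (k * i) * qint (k%:Z - i%:Z) ^+ i
         * qint (k%:Z - i%:Z + 1) ^ (n%:Z - i%:Z)
       - q ^+ ((k + 1) * i) * qint (k%:Z - i%:Z - 1) ^+ i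
         * qint (k%:Z - i%:Z) ^ (n%:Z - i%:Z))).
Proof.
move=> k_gt0; rewrite Akn_coef (le_poly_coef_explicit_pos q q_neq0 q_root _ _ k_gt0).
congr (_ * _); apply: eq_bigr => i _.
case: (leqP i n) => [le_in|lt_ni]; last by rewrite bin_small // mulr0 !mul0r.
have [m Em] : exists m, (k - i)%N = m.+1 by exists (k - i.+1)%N; rewrite subnSK.
have -> : k%:Z - i%:Z = m.+1%:Z by rewrite -Em subzn // ltnW.
have -> : m.+1%:Z - 1 = m%:Z by lia.
have -> : m.+1%:Z + 1 = m.+2%:Z by lia.
by rewrite (subzn le_in) Em.
Qed.

Lemma Akn_coef_sum k n :
  Akn k n = \sum_(i < k.+1) ((eigval q i ^+ n)`_(k - i) / q ^+ (i * i)
    - (if i == k :> nat then 0 else (eigval q i ^+ n)`_(k - i.+1) / q ^+ (i.+1 * i.+1))).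
Proof. by rewrite Akn_coef (le_poly_eig0_coef q q_neq0 q_root). Qed.

Lemma Akser_explicit k a b : (0 < k)%N ->
  Akser k a b = \sum_(i < k) Ak_term1 k i a b + \sum_(i < k.+1) Ak_term2 k i a b.
Proof.
move=> k_gt0; rewrite /Akser; case: b => [|b] /=; last first.
  rewrite !big1 ?addr0 // => i _; rewrite /Ak_term1 /Ak_term2 /psscale psmul_mon psinv_pow_one_minus.
    by rewrite mulr0 if_same mulr0.
  by rewrite mulr0 if_same mulr0.
rewrite Akn_coef_sum sumrB [RHS]addrC; congr (_ + _).
  by apply: eq_bigr => i _; rewrite Ak_term2E // -ltnS.
rewrite big_ord_recr /= eqxx addr0 -sumrN; apply: eq_bigr => i _.
by rewrite Ak_term1E // ltn_eqF.
Qed.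

Lemma Aser_explicit a b :
  Aser a b = gf_first a b + \sum_(i < b) gf_term i.+1 a b.
Proof.
rewrite /Aser gf_firstE; case: b => [|b]; first by rewrite big_ord0 mulr0 addr0.
rewrite /= Akn_coef (le_poly_coefS q q_neq0 q_root); congr (_ + _).
by apply: eq_bigr => i _; rewrite gf_termE ltn_ord.
Qed.

Theorem mainTheorem1 :
  (exists S : ps, ps_sum (fun i => gf_term i.+1) S /\
     forall a b, Aser a b = gf_first a b + S a b) /\
  (forall k : nat, (1 <= k)%N -> forall a b,
     Akser k a b =
       \sum_(i < k) Ak_term1 k i a b + \sum_(i < k.+1) Ak_term2 k i a b) /\
  (forall k n : nat, (1 <= k)%N ->
     Akn k n =
       q ^- (k * k) *
       \sum_(i < k) ((-1) ^+ i * ('C(n, i))%:R *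
          (q ^+ (k * i) * qint (k%:Z - i%:Z) ^+ i
             * qint (k%:Z - i%:Z + 1) ^ (n%:Z - i%:Z)
           - q ^+ ((k + 1) * i) * qint (k%:Z - i%:Z - 1) ^+ i
             * qint (k%:Z - i%:Z) ^ (n%:Z - i%:Z)))
     /\
     Akn k n =
       \sum_(i < k) (('C(n, i))%:R * q ^ (- ((k%:Z - i%:Z) ^+ 2)) *
          (qint (i%:Z - k%:Z) ^+ i * qint (k%:Z - i%:Z + 1) ^ (n%:Z - i%:Z)
           - qint (i%:Z - k%:Z + 1) ^+ i * qint (k%:Z - i%:Z) ^ (n%:Z - i%:Z)))).
Proof.
split; last split=> [k k_gt0 a b|k n k_gt0].
(* The term with index [i.+1] is divisible by [y^(i+1)], so only [i < b] contributes to the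
   coefficient of [y^b] and the partial sums are constant from [b] on. *)
- exists (fun a b => \sum_(i < b) gf_term i.+1 a b); split=> [a b|]; last exact: Aser_explicit.
  exists b => M le_bM; rewrite -(subnKC le_bM) big_split_ord /= [X in _ + X]big1 ?addr0 // => i _.
  have lt_bi : (b < (b + i).+1)%N by rewrite ltnS leq_addr.
  by rewrite gf_termE /= [(_ <= b)%N]leqNgt lt_bi [(_ < b)%N]ltnNge (ltnW lt_bi) subr0.
- exact: Akser_explicit.
- by split; [apply: Akn_explicit_pos|apply: Akn_explicit].
Qed.
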